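(* A generalized bitopological space $(X,\mu_1,\mu_2)$ is pairwise $T_{\frac38}$ if and only if every countable subset of $X$ is pairwise $\lambda$-closed.
   Context: Countable means finite or countably infinite. A generalized topology on a nonempty set $X$ is a collection $\mu$ of subsets of $X$ that contains $\emptyset$ and is closed under arbitrary unions ($X$ itself need not belong to $\mu$). Members of $\mu$ are called $\mu$-open and their complements $\mu$-closed. A generalized bitopological space (GBT-space) $(X,\mu_1,\mu_2)$ is a nonempty set $X$ with two generalized topologies $\mu_1,\mu_2$. The space is pairwise $T_{\frac38}$ if for every countable subset $P$ of $X$ and every $y\in X-P$ there exists a set $A_y$ containing $P$ and disjoint from $\{y\}$ such that $A_y$ is $\mu_i$-open for some $i\in\{1,2\}$ or $\mu_j$-closed for some $j\in\{1,2\}$. For $A\subset X$, $A_{\mu}^{\wedge}=\bigcap\{U\in\mu: A\subset U\}$ (equal to $X$ if no $\mu$-open set contains $A$); $A$ is a $\wedge_{\mu}$-set if $A=A_{\mu}^{\wedge}$. $A$ is pairwise $\lambda$-closed if $A=(F_1\cap F_2)\cap(L_1\cap L_2)$ where $F_1,F_2$ are respectively $\mu_1$-closed and $\mu_2$-closed and $L_1,L_2$ are respectively a $\wedge_{\mu_1}$-set and a $\wedge_{\mu_2}$-set. *)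

(* Defs.v *)
From mathcomp Require Import all_boot.
From mathcomp Require Import boolp classical_sets cardinality.

Set Implicit Arguments.
Unset Strict Implicit.
Unset Printing Implicit Defensive.

Local Open Scope classical_set_scope.

(* The whole space need not be open. *)
Record gtopology (X : Type) := GTopology {
  gopen : set (set X);
  gopen0 : gopen set0;
  gopen_bigcup : forall F : set (set X),
    F `<=` gopen -> gopen (\bigcup_(U in F) U) }.

Definition gclosed (X : Type) (mu : gtopology X) (A : set X) : Prop :=
  gopen mu (~` A).

Record gbtSpace := GbtSpace {
  gbt_carrier :> Type;
  gbt_nonempty : [set: gbt_carrier] !=set0;
  mu1 : gtopology gbt_carrier;
  mu2 : gtopology gbt_carrier }.

Arguments mu1 {g}.
Arguments mu2 {g}.

(* The intersection of the empty family is the whole space. *)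
Definition wedge (X : Type) (mu : gtopology X) (A : set X) : set X :=
  \bigcap_(U in [set U | gopen mu U /\ A `<=` U]) U.

Definition wedge_set (X : Type) (mu : gtopology X) (A : set X) : Prop :=
  A = wedge mu A.

Definition pairwise_T38 (X : gbtSpace) : Prop :=
  forall P : set X, countable P -> forall y : X, (~` P) y ->
  exists A : set X,
    [/\ P `<=` A,
        A `&` [set y] = set0
      & (gopen mu1 A \/ gopen mu2 A) \/ (gclosed mu1 A \/ gclosed mu2 A)].

Definition pairwise_lambda_closed (X : gbtSpace) (A : set X) : Prop :=
  exists F1 F2 L1 L2 : set X,
    [/\ gclosed mu1 F1 /\ gclosed mu2 F2,
        wedge_set mu1 L1 /\ wedge_set mu2 L2
      & A = (F1 `&` F2) `&` (L1 `&` L2)].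

(* Main.v *)
Require Import Defs.
From mathcomp Require Import all_boot.
From mathcomp Require Import boolp classical_sets cardinality.

Local Open Scope classical_set_scope.

(** For the forward direction, take F_i to be the mu_i-closure of A and L_i the
    wedge of A: each separating set given by the axiom contains one of these four
    sets.  Conversely, a point y outside A misses some F_i, which then separates,
    or some L_i, and then a mu_i-open superset of L_i separates. *)

Lemma gclosed_bigcap {X : Type} (mu : gtopology X) (F : set (set X)) :
  F `<=` gclosed mu -> gclosed mu (\bigcap_(C in F) C).
Proof.
move=> Fcl; rewrite /gclosed setC_bigcap -(bigcup_image F setC id).
by apply: gopen_bigcup => _ [C FC <-]; exact: Fcl.
Qed.

(** The family is never empty: [set0] is open, so the whole space is closed even when it is not
    open. *)
Definition gclosure {X : Type} (mu : gtopology X) (A : set X) : set X :=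
  \bigcap_(C in [set C | gclosed mu C /\ A `<=` C]) C.

Lemma gclosed_gclosure {X : Type} (mu : gtopology X) (A : set X) :
  gclosed mu (gclosure mu A).
Proof. by apply: gclosed_bigcap => C []. Qed.

Lemma subset_gclosure {X : Type} (mu : gtopology X) (A : set X) :
  A `<=` gclosure mu A.
Proof. by move=> x Ax C [_]; exact. Qed.

Lemma subset_wedge {X : Type} (mu : gtopology X) (A : set X) :
  A `<=` wedge mu A.
Proof. by move=> x Ax U [_]; exact. Qed.

(** An open set contains [A] exactly when it contains [wedge mu A], so both wedges intersect the
    same family. *)
Lemma wedge_set_wedge {X : Type} (mu : gtopology X) (A : set X) :
  wedge_set mu (wedge mu A).
Proof.
apply/seteqP; split; first exact: subset_wedge.
by move=> x xA U [oU AU]; apply: xA; split=> // z; apply.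
Qed.

Lemma wedge_set_separation {X : Type} (mu : gtopology X) (L : set X) (y : X) :
  wedge_set mu L -> ~ L y -> exists U, [/\ gopen mu U, L `<=` U & ~ U y].
Proof.
(* After the rewrite, [U] has to contain [wedge mu L], which every open superset of [L] does. *)
move=> -> nLy; apply: contrapT => nU; apply: nLy => U [oU LU].
apply: contrapT => nUy; apply: nU; exists U; split=> // z; exact.
Qed.

Lemma setI1_eq0 {X : Type} (A : set X) (y : X) : A `&` [set y] = set0 <-> ~ A y.
Proof.
split=> [A0 Ay|nAy]; first by have : set0 y by rewrite -A0.
by apply/seteqP; split=> // z [Az zy]; apply: nAy; rewrite -zy.
Qed.

Theorem theorem5p4 (X : gbtSpace) :
  pairwise_T38 X <->
  (forall A : set X, countable A -> pairwise_lambda_closed A).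
Proof.
split=> [T38 A cA|lcl P cP y nPy].
  exists (gclosure mu1 A), (gclosure mu2 A), (wedge mu1 A), (wedge mu2 A).
  split; [by split; exact: gclosed_gclosure|by split; exact: wedge_set_wedge|].
  apply/seteqP; split=> [x Ax|x [[c1 c2] [w1 w2]]].
    by split; split; [exact: subset_gclosure|exact: subset_gclosure
                     |exact: subset_wedge|exact: subset_wedge].
  apply: contrapT => nAx; have [B [AB /setI1_eq0 nBx]] := T38 A cA x nAx.
  (* Whichever of the four kinds [B] is, it belongs to the family defining the matching wedge or
     closure; [x] lies in that intersection, hence in [B]. *)
  by case=> -[] oB; apply: nBx; [exact: w1|exact: w2|exact: c1|exact: c2].
have [F1 [F2 [L1 [L2 [[cF1 cF2] [wL1 wL2] PE]]]]] := lcl P cP.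
have [PF1 PF2 PL1 PL2] : [/\ P `<=` F1, P `<=` F2, P `<=` L1 & P `<=` L2].
  by rewrite PE; split=> z [[]] ? ? [].
have [F1y|nF1y] := pselect (F1 y); last first.
  by exists F1; split=> //; [exact/setI1_eq0|right; left].
have [F2y|nF2y] := pselect (F2 y); last first.
  by exists F2; split=> //; [exact/setI1_eq0|right; right].
(* Unlike [F1] and [F2], the sets [L1] and [L2] need not be open or closed, so an open superset
   avoiding [y] replaces them. *)
have [L1y|nL1y] := pselect (L1 y); last first.
  have [U [oU LU nUy]] := wedge_set_separation mu1 L1 y wL1 nL1y.
  by exists U; split; [exact: subset_trans LU|exact/setI1_eq0|left; left].
have [L2y|nL2y] := pselect (L2 y); last first.
  have [U [oU LU nUy]] := wedge_set_separation mu2 L2 y wL2 nL2y.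
  by exists U; split; [exact: subset_trans LU|exact/setI1_eq0|left; right].
by case: nPy; rewrite PE.
Qed.
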